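(* The LQ cost function $c=c^{0,T}$ is a homogeneous polynomial of degree $2$ of the form \begin{equation} c(x,y)=\frac{x^*R_3(T)^{-1}R_4(T)x}{2}-x^*R_3(T)^{-1}y-\frac{y^*R_3^{-1}(-T)R_4(-T)y}{2},\qquad x,y\in\mathbb{R}^n. \end{equation}
   Context: Let $n,m\in\mathbb{N}$, $m\leq n$, $A\in\mathbb{R}^{n\times n}$, $B\in\mathbb{R}^{n\times m}$ of rank $m$, $Q\in\mathbb{R}^{n\times n}$ symmetric, and let $(A,B,Q,T)$ be the LQ optimal control problem of minimizing $\mathcal{A}(\gamma)=\frac12\int_0^T(|u|^2-\gamma^*Q\gamma)\,d\tau$ over admissible trajectories $\dot\gamma=A\gamma+Bu$, $u\in L^2$, with fixed endpoints; the LQ cost $c(x,y)$ is the infimum of this action among trajectories joining $x$ to $y$. Assume the Kalman condition $\mathrm{span}\{A^jb_i\}=\mathbb{R}^n$ ($b_i$ the columns of $B$) and $T<t^*$, where $t^*\in(0,+\infty]$ is the first conjugate time of the Hamiltonian system. Let $\Omega=\begin{pmatrix}\mathbb{0}_n & \mathbb{1}_n\\ -\mathbb{1}_n & \mathbb{0}_n\end{pmatrix}$, $H=\begin{pmatrix}BB^* & A\\ A^* & Q\end{pmatrix}$, and \begin{equation} e^{-\tau\Omega H}=\begin{pmatrix}R_1(\tau) & R_2(\tau)\\ R_3(\tau) & R_4(\tau)\end{pmatrix},\qquad\tau\in\mathbb{R}, \end{equation} the associated Hamiltonian flow. *)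

(* Defs.v *)
From HB Require Import structures.
From mathcomp Require Import all_boot all_order all_algebra.
From mathcomp Require Import all_classical all_reals all_analysis.
Set Implicit Arguments. Unset Strict Implicit. Unset Printing Implicit Defensive.
Import Order.TTheory GRing.Theory Num.Theory.
Import numFieldNormedType.Exports.
Local Open Scope classical_set_scope.
Local Open Scope ring_scope.

Section LQ.
Variable R : realType.

Definition expmx (p : nat) (M : 'M[R]_p) : 'M[R]_p :=
  \matrix_(i, j) limn (fun N => \sum_(k < N) ((M ^+ k) i j / (k`!)%:R)).

Variables (n m : nat).

Definition Omega : 'M[R]_(n + n) :=
  block_mx 0 1%:M (- 1%:M) 0.

Definition Hmx (A : 'M[R]_n) (B : 'M[R]_(n, m)) (Q : 'M[R]_n) : 'M[R]_(n + n) :=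
  block_mx (B *m B^T) A A^T Q.

Definition flow A B Q (tau : R) : 'M[R]_(n + n) :=
  expmx (- tau *: (Omega *m Hmx A B Q)).

Definition R1 A B Q tau : 'M[R]_n := ulsubmx (flow A B Q tau).
Definition R2 A B Q tau : 'M[R]_n := ursubmx (flow A B Q tau).
Definition R3 A B Q tau : 'M[R]_n := dlsubmx (flow A B Q tau).
Definition R4 A B Q tau : 'M[R]_n := drsubmx (flow A B Q tau).

Definition kalman (A : 'M[R]_n) (B : 'M[R]_(n, m)) : Prop :=
  forall v : 'cV[R]_n, exists (N : nat) (c : 'I_N -> 'I_m -> R),
    v = \sum_(j < N) \sum_(i < m) c j i *: (A ^+ j *m col i B).

(* Hamiltonian system  z' = -Omega H z,  z = (p, x) in R^n x R^n.
   t > 0 is a conjugate time iff there is a nontrivial solution with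
   x(0) = 0 and x(t) = 0. *)
Definition conjugate_time A B Q (t : R) : Prop :=
  0 < t /\ exists p0 : 'cV[R]_n, p0 != 0 /\
    dsubmx (flow A B Q t *m col_mx p0 (0 : 'cV[R]_n)) = 0.

(* first conjugate time t^* in (0, +oo] (inf of the empty set = +oo) *)
Definition tstar A B Q : \bar R :=
  ereal_inf [set (t%:E)%E | t in conjugate_time A B Q].

Definition mu := (@lebesgue_measure R).

(* admissible trajectories on [0,T]: u in L^2([0,T]; R^m), gamma absolutely
   continuous with gamma' = A gamma + B u a.e., i.e.
   gamma(t) = gamma(0) + int_0^t (A gamma + B u), with fixed endpoints. *)
Definition admissible A B (T : R) (x y : 'cV[R]_n)
    (gamma : R -> 'cV[R]_n) (u : R -> 'cV[R]_m) : Prop :=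
  [/\ forall i : 'I_m, measurable_fun (`[0, T]%classic) (fun t => u t i 0),
      forall i : 'I_m, mu.-integrable (`[0, T]%classic) (fun t => ((u t i 0) ^+ 2)%:E),
      forall i : 'I_n,
        mu.-integrable (`[0, T]%classic) (fun t => ((A *m gamma t + B *m u t) i 0)%:E),
      forall t, 0 <= t <= T -> forall i : 'I_n,
        gamma t i 0 = gamma 0 i 0 +
          \int[mu]_(s in (`[0, t]%classic)) ((A *m gamma s + B *m u s) i 0) &
      gamma 0 = x /\ gamma T = y].

Definition action (Q : 'M[R]_n) (T : R) (gamma : R -> 'cV[R]_n)
    (u : R -> 'cV[R]_m) : R :=
  2^-1 * \int[mu]_(t in (`[0, T]%classic))
    (\sum_(i < m) (u t i 0) ^+ 2 - ((gamma t)^T *m Q *m gamma t) 0 0).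

Definition lq_cost A B Q (T : R) (x y : 'cV[R]_n) : \bar R :=
  ereal_inf [set r : \bar R | exists (gamma : R -> 'cV[R]_n)
     (u : R -> 'cV[R]_m), admissible A B T x y gamma u /\
     r = (action Q T gamma u)%:E].

End LQ.

(* Main.v *)
Require Import Defs.
From HB Require Import structures.
From mathcomp Require Import all_boot all_order all_algebra.
From mathcomp Require Import all_classical all_reals all_analysis.
From mathcomp Require Import measurable_realfun.
From mathcomp Require Import ring lra.

(** Let N be the generator of the Hamiltonian flow and (p, xb) the solution of
    z' = N z whose x-component joins x to y; it exists because R3 is invertible
    on (0, T1] for some T1 > T. The matrix S(t) = R1(t + eps) R3(t + eps)^-1,
    eps = T1 - T, is symmetric and solves on all of [0, T] the Riccati equation
    S' = - A^T S - Q - S (B B^T S + A). For an admissible (gamma, u) put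
    e = gamma - xb, q = p + S e and w = u - B^T q. Completing the square,
    (p . gamma + q . e)' = |u|^2 - gamma . Q gamma - |w|^2, and e vanishes at
    both ends, so
      action = (p(T) . y - p(0) . x) / 2 + (1/2) int_0^T |w|^2,
    with w = 0 for the extremal itself. The product rule for the absolutely
    continuous gamma comes from Fubini's theorem; the boundary term is rewritten
    by means of R3(-T) = - R3(T)^T, a consequence of symplecticity. *)

Set Implicit Arguments. Unset Strict Implicit. Unset Printing Implicit Defensive.
Import Order.TTheory GRing.Theory Num.Theory.
Import numFieldNormedType.Exports.
Local Open Scope classical_set_scope.
Local Open Scope ring_scope.

(** * The matrix exponential as an entrywise power series in time *)

Section MatrixExponential.
Variables (R : realType) (p : nat).
Implicit Types (N M : 'M[R]_p) (t : R).

Definition expmx_coeff N i j (k : nat) : R := (N ^+ k) i j / k`!%:R.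

Lemma exprmxZ t N k : (t *: N) ^+ k = t ^+ k *: N ^+ k.
Proof.
elim: k => [|k IH]; first by rewrite !expr0 scale1r.
by rewrite !exprS IH /GRing.mul /= -scalemxAl -scalemxAr scalerA.
Qed.

Lemma expmxZE t N i j :
  expmx (t *: N) i j = limn (pseries (expmx_coeff N i j) t).
Proof.
rewrite mxE; congr (limn _); apply/funext => K.
rewrite /pseries /series /= big_mkord; apply: eq_bigr => k _.
by rewrite exprmxZ mxE /expmx_coeff [t ^+ k * _]mulrC mulrAC.
Qed.

(** The left side is the coefficient of the formally differentiated series, so splitting [N ^+ k.+1]
    as [N * N ^+ k] turns termwise differentiation into multiplication by [N] on the left. The
    companion [expmx_coeffSr] splits off the last factor instead. *)
Lemma expmx_coeffSl N i j k :
  k.+1%:R * expmx_coeff N i j k.+1 = \sum_l N i l * expmx_coeff N l j k.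
Proof.
rewrite /expmx_coeff factS natrM invfM mulrCA [_ * (_ / _)]mulrA.
rewrite divff ?pnatr_eq0// mul1r exprS mxE mulr_suml.
by apply: eq_bigr => l _; rewrite mulrA.
Qed.

Lemma expmx_coeffSr N i j k :
  k.+1%:R * expmx_coeff N i j k.+1 = \sum_l N l j * expmx_coeff N i l k.
Proof.
rewrite /expmx_coeff factS natrM invfM mulrCA [_ * (_ / _)]mulrA.
rewrite divff ?pnatr_eq0// mul1r exprSr mxE mulr_suml.
by apply: eq_bigr => l _; rewrite mulrA [N l j * _]mulrC.
Qed.

(** [C] dominates every absolute row sum of [N], so induction on [k] bounds each entry of [N ^+ k]
    by [C ^+ k]. Comparison with the scalar exponential series then gives convergence at every
    time. *)
Lemma expmx_coeff_bound N : exists2 C : R, 0 <= C &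
  forall i j k, `|expmx_coeff N i j k| <= exp_coeff C k.
Proof.
pose C : R := 1 + \sum_i \sum_j `|N i j|.
have S0 : 0 <= \sum_i \sum_j `|N i j|.
  by apply: sumr_ge0 => i _; apply: sumr_ge0.
have C0 : 0 <= C by rewrite addr_ge0.
exists C => // i j k; rewrite /expmx_coeff /exp_coeff /= normrM normfV normr_nat.
rewrite ler_wpM2r ?invr_ge0//.
elim: k i => [|k IH] i.
  rewrite !expr0 mxE; case: (i == j); rewrite ?normr1 ?normr0//.
rewrite !exprS mxE; apply: le_trans (ler_norm_sum _ _ _) _.
apply: (@le_trans _ _ ((\sum_l `|N i l|) * C ^+ k)).
  rewrite mulr_suml; apply: ler_sum => l _; rewrite normrM.
  by rewrite ler_wpM2l.
rewrite ler_wpM2r ?exprn_ge0//.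
rewrite -[leLHS]add0r lerD// [leRHS](bigD1 i)//= lerDl.
by apply: sumr_ge0 => l _; apply: sumr_ge0.
Qed.

Lemma is_cvg_pseries_expmx N i j t : cvgn (pseries (expmx_coeff N i j) t).
Proof.
have [C C0 HC] := expmx_coeff_bound N.
apply: normed_cvg.
apply: series_le_cvg (is_cvg_series_exp_coeff (C * `|t|)) => k /=.
- by [].
- by rewrite divr_ge0// exprn_ge0// mulr_ge0.
- by rewrite normrM normrX /exp_coeff /= exprMn mulrAC ler_wpM2r ?exprn_ge0//; exact: HC.
Qed.

Lemma cvg_pseries_lincomb (I : finType) (a : I -> R) (c : I -> nat -> R) t :
  (forall l, cvgn (pseries (c l) t)) ->
  pseries (fun k => \sum_l a l * c l k) t @ \oo -->
    \sum_l a l * limn (pseries (c l) t).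
Proof.
move=> cc.
have -> : pseries (fun k => \sum_l a l * c l k) t =
    (fun n => \sum_l a l * pseries (c l) t n).
  apply/funext => n; rewrite /pseries /series /=.
  under eq_bigr do rewrite mulr_suml.
  rewrite exchange_big /=; apply: eq_bigr => l _; rewrite mulr_sumr.
  by apply: eq_bigr => k _; rewrite mulrA.
apply: cvg_big => [|l _]; [exact: add_continuous|exact: cvgMl_tmp].
Qed.

Lemma pseries_diffs_expmx N i j :
  pseries_diffs (expmx_coeff N i j) =
  (fun k => \sum_l N i l * expmx_coeff N l j k).
Proof. by apply/funext => k; rewrite /pseries_diffs expmx_coeffSl. Qed.

Lemma is_derive_expmx N i j t :
  is_derive t 1 (fun s => expmx (s *: N) i j) ((N *m expmx (t *: N)) i j).
Proof.
have -> : (fun s => expmx (s *: N) i j) =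
   (fun s => limn (pseries (expmx_coeff N i j) s)).
  by apply/funext => s; rewrite expmxZE.
have -> : (N *m expmx (t *: N)) i j =
    limn (pseries (pseries_diffs (expmx_coeff N i j)) t).
  rewrite pseries_diffs_expmx; apply/esym/cvg_lim => //.
  rewrite mxE; under eq_bigr do rewrite expmxZE.
  by apply: cvg_pseries_lincomb => l; exact: is_cvg_pseries_expmx.
(* Termwise differentiation at [t] asks that the series and its first two formal derivatives
   converge at a point of larger modulus. By the recursion, both derived series are linear
   combinations of coefficient series, which converge everywhere. *)
apply: (@pseries_snd_diffs _ _ (`|t| + 1)).
- exact: is_cvg_pseries_expmx.
- rewrite pseries_diffs_expmx; apply/cvg_ex; eexists.
  by apply: cvg_pseries_lincomb => l; exact: is_cvg_pseries_expmx.
- have -> : pseries_diffs (pseries_diffs (expmx_coeff N i j)) =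
      (fun k => \sum_l N i l * \sum_r N l r * expmx_coeff N r j k).
    rewrite pseries_diffs_expmx; apply/funext => k; rewrite /pseries_diffs.
    rewrite mulr_sumr; apply: eq_bigr => l _.
    by rewrite mulrCA expmx_coeffSl.
  apply/cvg_ex; eexists; apply: cvg_pseries_lincomb => l.
  apply/cvg_ex; eexists; apply: cvg_pseries_lincomb => r.
  exact: is_cvg_pseries_expmx.
- by rewrite [ltRHS]ger0_norm ?addr_ge0// ltrDl.
Qed.

(** Both products are the sum of the same differentiated series, read once through the left
    recursion and once through the right one. *)
Lemma expmx_comm N t : N *m expmx (t *: N) = expmx (t *: N) *m N.
Proof.
apply/matrixP => i j; rewrite !mxE.
under eq_bigr do rewrite expmxZE.
under [RHS]eq_bigr do rewrite expmxZE mulrC.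
have cl := cvg_pseries_lincomb (a := N i) (fun l => @is_cvg_pseries_expmx N l j t).
have cr := cvg_pseries_lincomb (a := N ^~ j) (fun l => @is_cvg_pseries_expmx N i l t).
rewrite -(cvg_lim _ cl)// -(cvg_lim _ cr)//; congr (limn (pseries _ t)).
by apply/funext => k; rewrite -expmx_coeffSl -expmx_coeffSr.
Qed.

Lemma expmx0 N : expmx (0 *: N) = 1%:M.
Proof.
apply/matrixP => i j; rewrite expmxZE; apply: cvg_lim => //.
(* The partial sum of index [k] runs over exponents below [k], so at time 0 it equals the constant
   term from index 1 on. *)
apply: cvg_near_cst; exists 1%N => // k /= k0.
rewrite /pseries /series /= -(prednK k0) big_nat_recl//= big1 ?addr0.
  by rewrite /expmx_coeff !expr0 fact0 divr1 mulr1.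
by move=> l _; rewrite exprS mul0r mulr0.
Qed.

End MatrixExponential.

(** * Absolutely continuous functions as primitives, and their product rule *)

Section Primitive.
Variable R : realType.
Implicit Types (T t s : R) (f g F G : R -> R).
Local Notation mu := (@lebesgue_measure R).

Lemma measurable_itvR (i : interval R) : measurable ([set` i] : set (measurableTypeR R)).
Proof. exact: measurable_itv. Qed.

(** Both sides integrate [f s * g r] over the triangle 0 <= r <= s <= t, in the two orders allowed
    by Fubini's theorem. *)
Lemma Rintegral_triangle f g t :
  mu.-integrable `[0, t] (EFin \o f) -> mu.-integrable `[0, t] (EFin \o g) ->
  \int[mu]_(s in `[0, t]) (f s * \int[mu]_(r in `[0, s]) g r) =
  \int[mu]_(r in `[0, t]) (g r * \int[mu]_(s in `[r, t]) f s).
Proof.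
move=> intf intg.
(* Extension by zero moves the problem to the whole plane, where the triangle is cut out by the
   half-plane [W] alone. *)
pose ft := f \_ `[0, t]; pose gt := g \_ `[0, t].
have Eft : EFin \o ft = (EFin \o f) \_ `[0, t] by rewrite restrict_EFin.
have Egt : EFin \o gt = (EFin \o g) \_ `[0, t] by rewrite restrict_EFin.
have intft : mu.-integrable setT (EFin \o ft).
  by rewrite Eft; exact: (integrable_mkcond _ (measurable_itvR _)).1 intf.
have intgt : mu.-integrable setT (EFin \o gt).
  by rewrite Egt; exact: (integrable_mkcond _ (measurable_itvR _)).1 intg.
have mft : measurable_fun setT ft by case/integrableP: intft => /measurable_EFinP.
have mgt : measurable_fun setT gt by case/integrableP: intgt => /measurable_EFinP.
pose W : set (R * R) := [set z | z.2 <= z.1].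
have mW : measurable (W : set (measurableTypeR R * measurableTypeR R)).
  rewrite -[W]setTI.
  by apply: (@measurable_fun_le _ (measurableTypeR R * measurableTypeR R)%type).
pose h (z : R * R) : R := ft z.1 * gt z.2.
have mh : measurable_fun setT h.
  by apply: measurable_funM; apply: measurableT_comp.
have inth : (mu \x mu)%E.-integrable setT (EFin \o h).
  apply/integrable12ltyP; first exact/measurable_EFinP.
  (* The iterated integral of the absolute value of [h] factors into the product of the two L^1
     norms, hence is finite. *)
  have inner s : (\int[mu]_r `|(EFin \o h) (s, r)| =
      (`|ft s| * \int[mu]_r `|gt r|)%:E)%E.
    transitivity (\int[mu]_r (`|ft s|%:E * `|(EFin \o gt) r|))%E.
      by apply: eq_integral => r _; rewrite /h /= normrM EFinM.
    rewrite integralZl//; last exact: integrable_abse.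
    rewrite EFinM; congr (_ * _)%E.
    rewrite /Rintegral fineK//; apply: integrable_fin_num => //.
    exact: integrable_norm.
  under eq_integral do rewrite inner EFinM.
  have -> : (\int[mu]_x (`|ft x|%:E * (\int[mu]_r `|gt r|)%:E) =
    (\int[mu]_r `|gt r|)%:E * \int[mu]_x `|ft x|%:E)%E.
    under eq_integral do rewrite muleC.
    by rewrite integralZl//; exact: integrable_norm.
  have := integrable_fin_num measurableT (integrable_norm intft).
  by move=> /= /fineK <-; rewrite -EFinM ltry.
pose k (z : R * R) : R := if z.2 <= z.1 then h z else 0.
have intk : (mu \x mu)%E.-integrable setT (EFin \o k).
  have -> : EFin \o k = (EFin \o h) \_ W.
    apply/funext => z; rewrite /patch /k.
    have -> : (z \in W) = (z.2 <= z.1) by apply/idP/idP; rewrite inE.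
    by rewrite /=; case: ifP.
  apply: (integrable_mkcond _ mW).1; exact: integrableS inth.
have := Fubini intk.
have L s : (\int[mu]_r (EFin \o k) (s, r) =
   (((fun s => f s * \int[mu]_(r in `[0, s]) g r) \_ `[0, t]) s)%:E)%E.
  rewrite /patch; case: ifPn => s0t; last first.
    rewrite integral0_eq// => r _ /=; rewrite /k /h /= /ft /patch (negbTE s0t).
    by rewrite mul0r; case: ifP.
  move: (s0t); rewrite inE /= in_itv /= => /andP[s0 st].
  have igs : mu.-integrable `[0, s] (EFin \o g).
    by apply: integrableS intg => //; apply: subset_itvl; rewrite bnd_simp.
  transitivity (\int[mu]_(r in `[0%R, s]) ((f s)%:E * (g r)%:E))%E.
    rewrite [RHS]integral_mkcond; apply: eq_integral => r _.
    rewrite /= /k /h /ft /gt /patch s0t /= !mem_setE !in_itv /=.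
    case: (leP r s) => rs /=; rewrite ?andbT ?andbF//.
    rewrite (le_trans rs st) andbT.
    by case: (leP 0 r) => //; rewrite mulr0.
  rewrite integralZl// EFinM /Rintegral fineK//; exact: integrable_fin_num.
have L' r : (\int[mu]_s (EFin \o k) (s, r) =
   (((fun r => g r * \int[mu]_(s in `[r, t]) f s) \_ `[0, t]) r)%:E)%E.
  rewrite /patch; case: ifPn => r0t; last first.
    rewrite integral0_eq// => s _ /=; rewrite /k /h /= /gt /patch (negbTE r0t).
    by rewrite mulr0; case: ifP.
  move: (r0t); rewrite inE /= in_itv /= => /andP[r0 rt].
  have ifs : mu.-integrable `[r, t] (EFin \o f).
    by apply: integrableS intf => //; apply: subset_itvr; rewrite bnd_simp.
  transitivity (\int[mu]_(s in `[r, t]) ((g r)%:E * (f s)%:E))%E.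
    rewrite [RHS]integral_mkcond; apply: eq_integral => s _.
    rewrite /= /k /h /ft /gt /patch r0t /= !mem_setE !in_itv /=.
    case: (leP r s) => rs /=; rewrite ?andbT ?andbF//.
    rewrite (le_trans r0 rs) /=.
    by case: (leP s t) => //; rewrite ?mul0r// mulrC.
  rewrite integralZl// EFinM /Rintegral fineK//; exact: integrable_fin_num.
under eq_integral do rewrite L.
under [X in _ = X -> _]eq_integral do rewrite L'.
move=> /(congr1 fine) E.
rewrite [LHS]Rintegral_mkcond [RHS]Rintegral_mkcond; exact: E.
Qed.

(** Absolute continuity on [[0, T]] in the integral form used by [admissible]. No pointwise
    derivative is asked for, so trajectories driven by discontinuous controls are covered. *)
Definition primitive T F f :=
  mu.-integrable `[0, T] (EFin \o f) /\
  forall t, 0 <= t <= T -> F t = F 0 + \int[mu]_(s in `[0, t]) f s.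

Lemma integrable_subitv T t f : t <= T ->
  mu.-integrable `[0, T] (EFin \o f) -> mu.-integrable `[0, t] (EFin \o f).
Proof.
by move=> tT; apply: integrableS => //; apply: subset_itvl; rewrite bnd_simp.
Qed.

Lemma primitiveD T F f G g : primitive T F f -> primitive T G g ->
  primitive T (fun t => F t + G t) (fun t => f t + g t).
Proof.
move=> [intf HF] [intg HG]; split.
  by have := integrableD (measurable_itvR _) intf intg.
move=> t /[dup] t0T /andP[t0 tT]; rewrite (HF t)// (HG t)// RintegralD//.
- by rewrite addrACA.
- exact: integrable_subitv intf.
- exact: integrable_subitv intg.
Qed.

Lemma primitiveZ T (a : R) F f : primitive T F f ->
  primitive T (fun t => a * F t) (fun t => a * f t).
Proof.
move=> [intf HF]; split.
  by have := integrableZl (measurable_itvR _) a intf.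
move=> t /[dup] t0T /andP[t0 tT]; rewrite (HF t)// RintegralZl ?mulrDr//.
exact: integrable_subitv intf.
Qed.

Lemma primitive_cst T (a : R) : primitive T (fun=> a) (fun=> 0).
Proof.
split; first by apply: integrable0.
by move=> t _; rewrite Rintegral_cst// mul0r addr0.
Qed.

Lemma primitive_sum T (I : finType) (F f : I -> R -> R) :
  (forall i, primitive T (F i) (f i)) ->
  primitive T (fun t => \sum_i F i t) (fun t => \sum_i f i t).
Proof.
move=> H.
rewrite -(fct_sumE _ _ F) -(fct_sumE _ _ f).
elim/big_rec2: _ => [|i F' f' _ IH]; first exact: primitive_cst.
exact: primitiveD.
Qed.

Lemma primitive_within_continuous T F f : 0 <= T -> primitive T F f ->
  {within `[0, T], continuous F}.
Proof.
move=> T0 [intf HF].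
have c := parameterized_integral_continuous T0 intf.
have E : {in `[0, T]%classic, (fun t => F 0 + \int[mu]_(s in `[0, t]) f s) =1 F}.
  by move=> t; rewrite inE /= in_itv /= => /HF.
apply: (subspace_eq_continuous E) => x.
by apply: cvgD; [exact: cvg_cst|exact: c].
Qed.

Lemma within_continuous_integrableM T F f : 0 <= T ->
  {within `[0, T], continuous F} -> mu.-integrable `[0, T] (EFin \o f) ->
  mu.-integrable `[0, T] (EFin \o (fun t => F t * f t)).
Proof.
move=> T0 cF intf.
have mF : measurable_fun `[0, T] F by exact: subspace_continuous_measurable_fun.
have [c _ Hc] := EVT_max T0 cF.
have [d _ Hd] := EVT_min T0 cF.
have bF : [bounded F x | x in `[0, T]].
  exists (`|F c| + `|F d|); split; first exact: num_real.
  move=> M HM x /= xT; apply: le_trans (ltW HM).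
  have := Hc x xT; have := Hd x xT => Fd Fc.
  rewrite ler_norml; apply/andP; split.
    rewrite opprD; apply: le_trans Fd.
    have := ler_norm (- F d); rewrite normrN; have := normr_ge0 (F c); lra.
  apply: (le_trans Fc).
  have := ler_norm (F c); have := normr_ge0 (F d); lra.
have H := integrableMr (measurable_itvR _) mF bF intf.
exact: H.
Qed.

(** Replace [F] and [G] under the integral by initial value plus integral. The two double integrals
    that appear live on complementary triangles of a square, and together give the product of the
    integrals of [f] and [g]. *)
Lemma primitiveM T F f G g : 0 <= T -> primitive T F f -> primitive T G g ->
  primitive T (fun t => F t * G t) (fun t => f t * G t + F t * g t).
Proof.
move=> T0 pF pG.
have cF := primitive_within_continuous T0 pF.
have cG := primitive_within_continuous T0 pG.
case: (pF) (pG) => [intf HF] [intg HG].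
have i1 : mu.-integrable `[0, T] (EFin \o (fun t => f t * G t)).
  under [_ \o _]funext do rewrite /= mulrC.
  exact: within_continuous_integrableM.
have i2 : mu.-integrable `[0, T] (EFin \o (fun t => F t * g t)).
  exact: within_continuous_integrableM.
split; first exact: (integrableD (measurable_itvR _) i1 i2).
move=> t /[dup] t0T /andP[t0 tT].
have sub := integrable_subitv tT.
have := sub _ i1; have := sub _ i2; have := sub _ intf; have := sub _ intg.
move=> {}intg {}intf {}i2 {}i1.
have le0T s : 0 <= s <= t -> 0 <= s <= T.
  by move=> /andP[-> /= st]; exact: le_trans tT.
rewrite RintegralD//.
pose I h s := \int[mu]_(r in `[0, s]) h r.
have i1' : mu.-integrable `[0, t] (EFin \o (fun s => f s * I g s)).
  have : mu.-integrable `[0, t] (EFin \o (fun s => f s * G s - G 0 * f s)).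
    exact: integrableB i1 (integrableZl _ _ intf).
  apply: eq_integrable => // s; rewrite inE /= in_itv /= => /le0T /HG ->.
  by rewrite /I /=; congr EFin; ring.
have i2' : mu.-integrable `[0, t] (EFin \o (fun s => g s * I f s)).
  have : mu.-integrable `[0, t] (EFin \o (fun s => F s * g s - F 0 * g s)).
    exact: integrableB i2 (integrableZl _ _ intg).
  apply: eq_integrable => // s; rewrite inE /= in_itv /= => /le0T /HF ->.
  by rewrite /I /=; congr EFin; ring.
have E1 : \int[mu]_(s in `[0, t]) (f s * G s) =
   G 0 * I f t + \int[mu]_(s in `[0, t]) (f s * I g s).
  rewrite -RintegralZl// -RintegralD//;
    last exact: (integrableZl (measurable_itvR _) _ intf).
  apply: eq_Rintegral => s; rewrite inE /= in_itv /= => /le0T /HG ->.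
  by rewrite /I; ring.
have E2 : \int[mu]_(s in `[0, t]) (F s * g s) =
   F 0 * I g t + \int[mu]_(s in `[0, t]) (g s * I f s).
  rewrite -RintegralZl// -RintegralD//;
    last exact: (integrableZl (measurable_itvR _) _ intg).
  apply: eq_Rintegral => s; rewrite inE /= in_itv /= => /le0T /HF ->.
  by rewrite /I; ring.
have E3 : \int[mu]_(s in `[0, t]) (f s * I g s) =
   I f t * I g t - \int[mu]_(s in `[0, t]) (g s * I f s).
  rewrite Rintegral_triangle// /I -RintegralZl// -RintegralB//; last first.
    exact: (integrableZl (measurable_itvR _) _ intg).
  apply: eq_Rintegral => r; rewrite inE /= in_itv /= => /andP[r0 rt].
  rewrite -[in RHS](mulrC (g r)) -mulrBr; congr (_ * _).
  (* The difference of the two integrals is over the half-open interval from [r] to [t]; adding its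
     left endpoint changes nothing. *)
  rewrite (@Rintegral_itvB _ f (BLeft 0) (BRight t) r)//.
  rewrite Rintegral_itv_obnd_cbnd//.
  by apply: integrableS intf => //; apply: subset_itvr; rewrite bnd_simp.
by rewrite E1 E2 E3 (HF t)// (HG t)// /I; ring.
Qed.

Lemma continuous_primitive T F f : 0 < T ->
  (forall t, 0 <= t <= T -> is_derive t 1 F (f t)) ->
  (forall t, 0 <= t <= T -> {for t, continuous f}) -> primitive T F f.
Proof.
move=> T0 dF cf.
have cF t : 0 <= t <= T -> {for t, continuous F}.
  by move=> /dF d; apply: differentiable_continuous; apply/derivable1_diffP.
have cfw : {within `[0, T], continuous f}.
  by apply: continuous_in_subspaceT => t; rewrite inE /= in_itv /= => /cf.
split; first by apply: continuous_compact_integrable => //; exact: segment_compact.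
(* The fundamental theorem of calculus is applied on a nondegenerate interval, so [t = 0] is treated
   apart. *)
move=> t /andP[t0 tT]; move: t0; rewrite le_eqVlt => /predU1P[<-|t0].
  by rewrite set_itv1 Rintegral_set1 addr0.
have sT s : 0 <= s <= t -> 0 <= s <= T.
  by move=> /andP[-> /= st]; exact: le_trans tT.
rewrite /Rintegral (@continuous_FTC2 _ f F)//=.
- by rewrite [RHS]addrC subrK.
- by apply: continuous_subspaceW cfw; apply: subset_itvl; rewrite bnd_simp.
- split.
  + move=> x; rewrite in_itv/= => /andP[x0 xt].
    by have [] := dF x (sT x _); rewrite ?ltW.
  + apply: cvg_at_right_filter; apply: cF; by rewrite lexx ltW.
  + apply: cvg_at_left_filter; apply: cF; by rewrite tT ltW.
- move=> x; rewrite in_itv/= => /andP[x0 xt].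
  have [|_ <-] := dF x; first by rewrite sT// !ltW.
  by rewrite derive1E.
Qed.

End Primitive.

(** * Entrywise calculus for matrix-valued functions of time *)

Section MatrixDerivative.
Variable R : realType.
Implicit Types t s : R.

Definition is_derive_mx a b (F : R -> 'M[R]_(a, b)) t (dF : 'M[R]_(a, b)) :=
  forall i j, is_derive t 1 (fun s => F s i j) (dF i j).

Definition continuous_mx a b (F : R -> 'M[R]_(a, b)) t :=
  forall i j, {for t, continuous (fun s => F s i j)}.

Lemma is_derive1M (f g : R -> R) t (df dg : R) :
  is_derive t 1 f df -> is_derive t 1 g dg ->
  is_derive t 1 (fun s => f s * g s) (df * g t + f t * dg).
Proof.
move=> Hf Hg; have H := is_deriveM Hf Hg.
by apply: is_derive_eq; rewrite addrC /GRing.scale /= [g t * _]mulrC.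
Qed.

Lemma derivable1_sum (I : finType) (F : I -> R -> R) t :
  (forall i, derivable (F i) t 1) -> derivable (fun s => \sum_i F i s) t 1.
Proof.
move=> H; rewrite -(fct_sumE _ _ F); elim/big_ind: _ => [|f g|i _].
- exact: derivable_cst.
- exact: derivableD.
- exact: H.
Qed.

Lemma is_derive1_sum (I : finType) (F : I -> R -> R) (dF : I -> R) t :
  (forall i, is_derive t 1 (F i) (dF i)) ->
  is_derive t 1 (fun s => \sum_i F i s) (\sum_i dF i).
Proof.
move=> H; rewrite -(fct_sumE _ _ F); elim/big_ind2: _ => [|f df g dg|i _].
- exact: is_derive_cst.
- exact: is_deriveD.
- exact: H.
Qed.

Lemma derivable1_prod (I : finType) (F : I -> R -> R) t :
  (forall i, derivable (F i) t 1) -> derivable (fun s => \prod_i F i s) t 1.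
Proof.
move=> H; rewrite -(fct_prodE _ _ F); elim/big_ind: _ => [|f g|i _].
- exact: derivable_cst.
- exact: derivableM.
- exact: H.
Qed.

Lemma derivable_det n (X : R -> 'M[R]_n) t :
  (forall i j, derivable (fun s => X s i j) t 1) ->
  derivable (fun s => \det (X s)) t 1.
Proof.
move=> H; apply: derivable1_sum => w.
by apply: derivableM; [exact: derivable_cst|exact: derivable1_prod].
Qed.

Lemma derivable_adj n (X : R -> 'M[R]_n) t :
  (forall i j, derivable (fun s => X s i j) t 1) ->
  forall i j, derivable (fun s => \adj (X s) i j) t 1.
Proof.
move=> H i j; under [X in derivable X]funext do rewrite mxE /cofactor.
apply: derivableM; first exact: derivable_cst.
apply: derivable_det => k l; under [X in derivable X]funext do rewrite !mxE.
exact: H.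
Qed.

Lemma is_derive_mxM a b c (F : R -> 'M[R]_(a, b)) (G : R -> 'M[R]_(b, c)) t dF dG :
  is_derive_mx F t dF -> is_derive_mx G t dG ->
  is_derive_mx (fun s => F s *m G s) t (dF *m G t + F t *m dG).
Proof.
move=> HF HG i j; rewrite !mxE -big_split /=.
under [X in is_derive _ _ X]funext do rewrite mxE.
by apply: is_derive1_sum => k; exact: is_derive1M.
Qed.

Lemma is_derive_mx_unique a b (F : R -> 'M[R]_(a, b)) t dF dG :
  is_derive_mx F t dF -> is_derive_mx F t dG -> dF = dG.
Proof.
move=> HF HG; apply/matrixP => i j.
by rewrite -(@derive_val _ _ _ _ _ _ _ (HF i j)) -(@derive_val _ _ _ _ _ _ _ (HG i j)).
Qed.

Definition adj_inv n (M : 'M[R]_n) := (\det M)^-1 *: \adj M.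

Lemma adj_invE n (M : 'M[R]_n) : M \in unitmx -> adj_inv M = invmx M.
Proof. by rewrite /invmx => ->. Qed.

(* Unlike [invmx], which is the identity on singular matrices, [adj_inv] is
   given by one formula: X *m \adj X = \det X holds identically in t, which
   gives the derivative of the inverse without a neighbourhood argument. *)
Lemma is_derive_adj_inv n (X : R -> 'M[R]_n) t dX :
  X t \in unitmx -> is_derive_mx X t dX ->
  is_derive_mx (fun s => adj_inv (X s)) t
    (- (invmx (X t) *m dX *m invmx (X t))).
Proof.
move=> uX HX.
have derX i j : derivable (fun s => X s i j) t 1 by have [] := HX i j.
have dn0 : \det (X t) != 0 by rewrite -unitfE -unitmxE.
have Hd := derivableP (derivable_det derX).
set d' := 'D_1 _ t in Hd.
pose A' := \matrix_(i, j) 'D_1 (fun s => \adj (X s) i j) t.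
have HA : is_derive_mx (fun s => \adj (X s)) t A'.
  by move=> i j; rewrite mxE; apply: derivableP; exact: derivable_adj.
have E : dX *m \adj (X t) + X t *m A' = d'%:M.
  apply: is_derive_mx_unique (is_derive_mxM HX HA) _ => i j.
  under [X in is_derive _ _ X]funext do rewrite mul_mx_adj mxE.
  rewrite mxE; case: (i == j); rewrite ?mulr1n//.
  by under [X in is_derive _ _ X]funext do rewrite mulr0n; exact: is_derive_cst.
have EA : A' = invmx (X t) *m (d'%:M - dX *m \adj (X t)).
  by rewrite -E addrC addKr mulKmx.
have HV := is_deriveV dn0 Hd.
move=> i j; under [X in is_derive _ _ X]funext do rewrite mxE.
have := is_derive1M HV (HA i j).
set D := (X in is_derive _ _ _ X) => HD.
suff <- : D = (- (invmx (X t) *m dX *m invmx (X t))) i j by [].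
have adjE : \adj (X t) = \det (X t) *: invmx (X t).
  by rewrite -adj_invE// /adj_inv scalerA divff// scale1r.
(* The two terms containing [d'], one from the inverse determinant and one from [A'], cancel. *)
rewrite /D EA mulmxBr mul_mx_scalar adjE -scalemxAr -scalemxAr mulmxA !mxE.
rewrite /GRing.scale /=.
by field.
Qed.

Lemma is_derive_mx_continuous a b (F : R -> 'M[R]_(a, b)) t dF :
  is_derive_mx F t dF -> continuous_mx F t.
Proof.
move=> H i j; have [d _] := H i j.
by apply: differentiable_continuous; apply/derivable1_diffP.
Qed.

Lemma continuous_mxM a b c (F : R -> 'M[R]_(a, b)) (G : R -> 'M[R]_(b, c)) t :
  continuous_mx F t -> continuous_mx G t -> continuous_mx (fun s => F s *m G s) t.
Proof.
move=> HF HG i j.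
rewrite (_ : (fun s => _) = (fun s => \sum_k F s i k * G s k j)); last first.
  by apply/funext => s; rewrite mxE.
by apply: cvg_big => [|k _]; [exact: add_continuous|apply: cvgM; [exact: HF|exact: HG]].
Qed.

Lemma continuous_mxD a b (F G : R -> 'M[R]_(a, b)) t :
  continuous_mx F t -> continuous_mx G t -> continuous_mx (fun s => F s + G s) t.
Proof.
move=> HF HG i j.
rewrite (_ : (fun s => _) = (fun s => F s i j + G s i j)); last first.
  by apply/funext => s; rewrite mxE.
by apply: cvgD; [exact: HF|exact: HG].
Qed.

Lemma continuous_mxN a b (F : R -> 'M[R]_(a, b)) t :
  continuous_mx F t -> continuous_mx (fun s => - F s) t.
Proof.
move=> HF i j; rewrite (_ : (fun s => _) = (fun s => - F s i j)); last first.
  by apply/funext => s; rewrite mxE.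
by apply: cvgN; exact: HF.
Qed.

Definition primitive_mx a b (T : R) (F f : R -> 'M[R]_(a, b)) :=
  forall i j, primitive T (fun t => F t i j) (fun t => f t i j).

Lemma continuous_primitive_mx a b (T : R) (F f : R -> 'M[R]_(a, b)) : 0 < T ->
  (forall t, 0 <= t <= T -> is_derive_mx F t (f t)) ->
  (forall t, 0 <= t <= T -> continuous_mx f t) -> primitive_mx T F f.
Proof.
move=> T0 HF Hf i j; apply: continuous_primitive => // t tT; first exact: HF.
exact: Hf.
Qed.

Lemma eq_primitive (T : R) (F G f g : R -> R) : 0 <= T ->
  (forall t, 0 <= t <= T -> F t = G t) -> (forall t, 0 <= t <= T -> f t = g t) ->
  primitive T F f -> primitive T G g.
Proof.
move=> T0 FG fg [intf HF]; split.
  apply: eq_integrable intf => // t; rewrite inE /= in_itv /= => /fg E.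
  by rewrite /= E.
move=> t /[dup] tT /andP[t0 tT']; rewrite -!FG ?lexx// HF//; congr (_ + _).
apply: eq_Rintegral => s; rewrite inE /= in_itv /= => /andP[s0 st].
by rewrite fg// s0 (le_trans st).
Qed.

Lemma eq_primitive_mx a b (T : R) (F G f g : R -> 'M[R]_(a, b)) : 0 <= T ->
  (forall t, 0 <= t <= T -> F t = G t) -> (forall t, 0 <= t <= T -> f t = g t) ->
  primitive_mx T F f -> primitive_mx T G g.
Proof.
move=> T0 FG fg H i j; apply: eq_primitive (H i j) => // t tT.
- by rewrite FG.
- by rewrite fg.
Qed.

(** The differentiation is done on [adj_inv], whose derivative is continuous because it is a product
    of continuous factors. The result passes to [invmx] since a primitive depends only on values in
    [[0, T]], where the two inverses agree. *)
Lemma primitive_mx_invmx n (T : R) (X dX : R -> 'M[R]_n) : 0 < T ->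
  (forall t, 0 <= t <= T -> X t \in unitmx) ->
  (forall t, 0 <= t <= T -> is_derive_mx X t (dX t)) ->
  (forall t, 0 <= t <= T -> continuous_mx dX t) ->
  primitive_mx T (fun t => invmx (X t))
    (fun t => - (invmx (X t) *m dX t *m invmx (X t))).
Proof.
move=> T0 uX HX cX.
pose Y t := adj_inv (X t).
have YE t : 0 <= t <= T -> Y t = invmx (X t) by move=> /uX; exact: adj_invE.
have HY t : 0 <= t <= T -> is_derive_mx Y t (- (Y t *m dX t *m Y t)).
  by move=> tT; rewrite YE//; apply: is_derive_adj_inv; [exact: uX|exact: HX].
have cY t : 0 <= t <= T -> continuous_mx Y t.
  by move=> /HY; exact: is_derive_mx_continuous.
apply: (@eq_primitive_mx _ _ _ Y _ (fun t => - (Y t *m dX t *m Y t))).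
- exact: ltW.
- exact: YE.
- by move=> t tT; rewrite YE.
apply: continuous_primitive_mx => // t tT.
by apply/continuous_mxN/continuous_mxM; [apply: continuous_mxM|]; auto.
Qed.

Lemma primitive_mxD a b (T : R) (F f G g : R -> 'M[R]_(a, b)) :
  primitive_mx T F f -> primitive_mx T G g ->
  primitive_mx T (fun t => F t + G t) (fun t => f t + g t).
Proof.
move=> HF HG i j; have := primitiveD (HF i j) (HG i j).
by congr (primitive T _ _); apply/funext => t; rewrite mxE.
Qed.

Lemma primitive_mxZ a b (T c : R) (F f : R -> 'M[R]_(a, b)) :
  primitive_mx T F f -> primitive_mx T (fun t => c *: F t) (fun t => c *: f t).
Proof.
move=> HF i j; have := primitiveZ c (HF i j).
by congr (primitive T _ _); apply/funext => t; rewrite mxE.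
Qed.

Lemma primitive_mxB a b (T : R) (F f G g : R -> 'M[R]_(a, b)) :
  primitive_mx T F f -> primitive_mx T G g ->
  primitive_mx T (fun t => F t - G t) (fun t => f t - g t).
Proof.
move=> HF /(primitive_mxZ (-1)) HG i j; have := primitive_mxD HF HG i j.
by congr (primitive T _ _); apply/funext => t; rewrite scaleN1r.
Qed.

Lemma primitive_mx_cst a b (T : R) (M : 'M[R]_(a, b)) :
  primitive_mx T (fun=> M) (fun=> 0).
Proof.
move=> i j; have := primitive_cst T (M i j).
by congr (primitive T _ _); apply/funext => t; rewrite mxE.
Qed.

Lemma primitive_mxM a b c (T : R) (F f : R -> 'M[R]_(a, b))
    (G g : R -> 'M[R]_(b, c)) : 0 <= T ->
  primitive_mx T F f -> primitive_mx T G g ->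
  primitive_mx T (fun t => F t *m G t) (fun t => f t *m G t + F t *m g t).
Proof.
move=> T0 HF HG i j.
have := primitive_sum (fun k => primitiveM T0 (HF i k) (HG k j)).
congr (primitive T _ _); apply/funext => t; rewrite !mxE//.
by rewrite -big_split.
Qed.

Lemma primitive_mx_tr a b (T : R) (F f : R -> 'M[R]_(a, b)) :
  primitive_mx T F f -> primitive_mx T (fun t => (F t)^T) (fun t => (f t)^T).
Proof.
move=> HF i j; have := HF j i.
by congr (primitive T _ _); apply/funext => t; rewrite mxE.
Qed.

Lemma primitive_mx_sub a b a' b' (u : 'I_a' -> 'I_a) (v : 'I_b' -> 'I_b) (T : R)
    (F f : R -> 'M[R]_(a, b)) : primitive_mx T F f ->
  primitive_mx T (fun t => mxsub u v (F t)) (fun t => mxsub u v (f t)).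
Proof.
move=> HF i j; have := HF (u i) (v j).
by congr (primitive T _ _); apply/funext => t; rewrite mxE.
Qed.

(** Conservation laws of the flow, such as its inverse and its symplecticity, are derived from
    this. *)
Lemma primitive_mx_eq0 a b (T : R) (F : R -> 'M[R]_(a, b)) t : 0 <= t <= T ->
  primitive_mx T F (fun=> 0) -> F t = F 0.
Proof.
move=> tT HF; apply/matrixP => i j; have [_ ->//] := HF i j.
under eq_Rintegral do rewrite mxE.
by rewrite Rintegral_cst// mul0r addr0.
Qed.

End MatrixDerivative.

(** * The Euclidean inner product on column vectors *)

Section Dot.
Variable R : realType.

Definition dot k (a b : 'cV[R]_k) : R := (a^T *m b) 0 0.

Lemma dotE k (a b : 'cV[R]_k) : dot a b = \sum_i a i 0 * b i 0.
Proof. by rewrite /dot mxE; apply: eq_bigr => i _; rewrite mxE. Qed.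

Lemma dotC k (a b : 'cV[R]_k) : dot a b = dot b a.
Proof. by rewrite !dotE; apply: eq_bigr => i _; rewrite mulrC. Qed.

Lemma dotDl k (a b c : 'cV[R]_k) : dot (a + b) c = dot a c + dot b c.
Proof. by rewrite /dot linearD /= mulmxDl mxE. Qed.

Lemma dotDr k (a b c : 'cV[R]_k) : dot c (a + b) = dot c a + dot c b.
Proof. by rewrite /dot mulmxDr mxE. Qed.

Lemma dotNl k (a c : 'cV[R]_k) : dot (- a) c = - dot a c.
Proof. by rewrite /dot linearN /= mulNmx mxE. Qed.

Lemma dotNr k (a c : 'cV[R]_k) : dot c (- a) = - dot c a.
Proof. by rewrite /dot mulmxN mxE. Qed.

Lemma dot0l k (a : 'cV[R]_k) : dot 0 a = 0.
Proof. by rewrite /dot trmx0 mul0mx mxE. Qed.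

Lemma dotMl k l (M : 'M[R]_(l, k)) (a : 'cV[R]_k) (b : 'cV[R]_l) :
  dot (M *m a) b = dot a (M^T *m b).
Proof. by rewrite /dot trmx_mul mulmxA. Qed.

Lemma dotMr k l (M : 'M[R]_(l, k)) (a : 'cV[R]_k) (b : 'cV[R]_l) :
  dot b (M *m a) = dot (M^T *m b) a.
Proof. by rewrite dotMl trmxK. Qed.

Definition sqnorm k (a : 'cV[R]_k) := dot a a.

Lemma sqnorm_ge0 k (a : 'cV[R]_k) : 0 <= sqnorm a.
Proof. by rewrite /sqnorm dotE; apply: sumr_ge0 => i _; rewrite -expr2 sqr_ge0. Qed.

Lemma primitive_dot k (T : R) (F f G g : R -> 'cV[R]_k) : 0 <= T ->
  primitive_mx T F f -> primitive_mx T G g ->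
  primitive T (fun t => dot (F t) (G t)) (fun t => dot (f t) (G t) + dot (F t) (g t)).
Proof.
move=> T0 HF HG; have := primitive_mxM T0 (primitive_mx_tr HF) HG 0 0.
by congr (primitive T _ _); apply/funext => t; rewrite mxE.
Qed.

End Dot.

(** * Symplecticity of the flow and invertibility of its block [R3] *)

Section HamiltonianFlow.
Variables (R : realType) (n m : nat).
Variables (A : 'M[R]_n) (B : 'M[R]_(n, m)) (Q : 'M[R]_n).
Local Notation E := (flow A B Q).
Local Notation R1 := (R1 A B Q).
Local Notation R2 := (R2 A B Q).
Local Notation R3 := (R3 A B Q).
Local Notation R4 := (R4 A B Q).
Local Notation J := (Omega R n).
Implicit Types (t T : R).

(** This is $-\Omega H$ multiplied out. On z = (p, x) it reads p' = - A^T p - Q x and x' = A x + B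
    B^T p, so the extremal control is B^T p. *)
Definition ham_gen : 'M[R]_(n + n) := block_mx (- A^T) (- Q) (B *m B^T) A.

Lemma flowE t : E t = expmx (t *: ham_gen).
Proof.
rewrite /flow scaleNr -scalerN; congr (expmx (t *: _)).
rewrite /Omega /Hmx mulmx_block !mul0mx !mul1mx !mulNmx !mul1mx !addr0 !add0r.
by rewrite opp_block_mx !opprK.
Qed.

Lemma flow_block t : E t = block_mx (R1 t) (R2 t) (R3 t) (R4 t).
Proof. by rewrite /R1 /R2 /R3 /R4 submxK. Qed.

Lemma flow_comm t : ham_gen *m E t = E t *m ham_gen.
Proof. by rewrite flowE expmx_comm. Qed.

Lemma flow0 : E 0 = 1%:M.
Proof. by rewrite flowE expmx0. Qed.

(** The affine change of time serves three uses: the flow itself, the backward flow ([b = -1]), and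
    the shifted flow of the Riccati solution ([a = eps]). *)
Lemma is_derive_flow (a b t : R) :
  is_derive_mx (fun s => E (a + b * s)) t (b *: (ham_gen *m E (a + b * t))).
Proof.
move=> i j; rewrite mxE mulrC flowE.
under [X in is_derive _ _ X]funext do rewrite flowE.
have Hf := is_derive_expmx ham_gen i j (a + b * t).
have Hg : is_derive t 1 (fun s : R => a + b * s) b.
  have := is_deriveD (is_derive_cst a t (1 : R)) (is_deriveZ b (is_derive_id t (1 : R))).
  by rewrite add0r scaler1.
exact: (@is_derive1_comp _ (fun s => expmx (s *: ham_gen) i j)
  (fun s => a + b * s) t _ _ Hf Hg).
Qed.

Lemma primitive_flow (a b T : R) : 0 < T ->
  primitive_mx T (fun s => E (a + b * s)) (fun t => b *: (ham_gen *m E (a + b * t))).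
Proof.
move=> T0; apply: continuous_primitive_mx => // t _; first exact: is_derive_flow.
have cE := is_derive_mx_continuous (is_derive_flow a b t).
have cN : continuous_mx (fun=> ham_gen) t by move=> k l; exact: cvg_cst.
have cNE := continuous_mxM cN cE.
move=> i j.
rewrite (_ : (fun s => _) = (fun s => b * (ham_gen *m E (a + b * s)) i j)); last first.
  by apply/funext => s; rewrite mxE.
by apply: cvgM; [exact: cvg_cst|exact: cNE].
Qed.

Lemma primitive_flow0 T : 0 < T -> primitive_mx T E (fun t => ham_gen *m E t).
Proof.
move=> T0; have := primitive_flow 0 1 T0.
congr (primitive_mx T _ _); apply/funext => t; first by rewrite add0r mul1r.
by rewrite scale1r add0r mul1r.
Qed.

(** The product has zero derivative because the generator commutes with the flow, and it is the
    identity at time 0. *)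
Lemma flowN T : 0 < T -> E (- T) *m E T = 1%:M.
Proof.
move=> T0; have H := primitive_mxM (ltW T0) (primitive_flow 0 (-1) T0) (primitive_flow0 T0).
have E0 := @primitive_mx_eq0 _ _ _ T (fun t => E (0 + -1 * t) *m E t) T.
move: E0; rewrite add0r mulN1r mulr0 addr0 flow0 mulmx1; apply.
  by rewrite lexx ltW.
have -> // : (fun=> 0) = (fun t : R => -1 *: (ham_gen *m E (0 + -1 * t)) *m E t +
    E (0 + -1 * t) *m (ham_gen *m E t)) :> (R -> 'M[R]_(n + n)).
by apply/funext => t; rewrite flow_comm mulmxA -scalemxAl scaleN1r addNr.
Qed.

Hypothesis symQ : Q^T = Q.

Lemma ham_gen_symplectic : ham_gen^T *m J + J *m ham_gen = 0.
Proof.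
rewrite /ham_gen /Omega tr_block_mx !mulmx_block.
rewrite !(mulmx0, mul0mx, mulmx1, mul1mx, mulmxN, mulNmx, addr0, add0r).
rewrite !raddfN /= trmx_mul !trmxK symQ.
by rewrite add_block_mx !opprK !(addNr, addrN) block_mx0.
Qed.

(** With N = [ham_gen], the derivative of the left side is E^T (N^T J + J N) E, which vanishes by
    [ham_gen_symplectic]. *)
Lemma flow_symplectic T : 0 < T -> (E T)^T *m J *m E T = J.
Proof.
move=> T0; have PE := primitive_flow0 T0.
have H := primitive_mxM (ltW T0)
  (primitive_mxM (ltW T0) (primitive_mx_tr PE) (primitive_mx_cst T J)) PE.
have E0 := @primitive_mx_eq0 _ _ _ T (fun t => (E t)^T *m J *m E t) T.
move: E0; rewrite flow0 trmx1 mulmx1 mul1mx; apply; first by rewrite lexx ltW.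
move: H; congr (primitive_mx T _ _); apply/funext => t.
rewrite mulmx0 addr0 trmx_mul -!mulmxA -mulmxDr !mulmxA -mulmxDl.
by rewrite ham_gen_symplectic mul0mx mulmx0.
Qed.

(** Upper left block of the symplectic identity; it makes the Riccati solution R1 R3^-1
    symmetric. *)
Lemma R13_sym T : 0 < T -> (R1 T)^T *m R3 T = (R3 T)^T *m R1 T.
Proof.
move=> T0; have := flow_symplectic T0.
rewrite flow_block tr_block_mx /Omega !mulmx_block.
rewrite !(mulmx0, mul0mx, mulmx1, mul1mx, mulmxN, mulNmx, addr0, add0r).
by move=> /eq_block_mx[+ _ _ _] => /eqP; rewrite addrC subr_eq0 => /eqP.
Qed.

(** Multiplying the symplectic identity by E(-T) on the right gives E(T)^T J = J E(-T), whose upper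
    left blocks are compared. *)
Lemma R3N T : 0 < T -> R3 (- T) = - (R3 T)^T.
Proof.
move=> T0.
have /(congr1 (fun M => M *m E (- T))) := flow_symplectic T0.
rewrite -mulmxA (mulmx1C (flowN T0)) mulmx1.
rewrite [E T]flow_block [E (- T)]flow_block tr_block_mx /Omega !mulmx_block.
rewrite !(mulmx0, mul0mx, mulmx1, mul1mx, mulmxN, mulNmx, addr0, add0r).
by move=> /eq_block_mx[-> _ _ _].
Qed.

(** The solution starting at (p0, 0) has x-component R3(t) p0, so a nonzero kernel vector of R3(t)
    makes t conjugate. *)
Lemma R3_unit t : 0 < t -> ~ conjugate_time A B Q t -> R3 t \in unitmx.
Proof.
move=> t0 nc; rewrite -unitmx_tr unitmxE unitfE; apply/negP => /det0P[v v0 vR].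
apply: nc; split => //; exists v^T; split.
  by apply: contraNneq v0 => /(congr1 trmx); rewrite trmxK trmx0 => ->.
rewrite flow_block mul_block_col col_mxKd mulmx0 addr0.
by rewrite -[R3 t]trmxK -trmx_mul vR trmx0.
Qed.

(** The strict inequality leaves room for some [T1] between [T] and the first conjugate time. The
    margin [T1 - T] is the time shift that regularises the Riccati solution at 0. *)
Lemma R3_unit_past T : (T%:E < tstar A B Q)%E ->
  exists2 T1, T < T1 & forall t, 0 < t <= T1 -> R3 t \in unitmx.
Proof.
move=> Tt.
have [T1 TT1 T1t] : exists2 T1, T < T1 & (T1%:E < tstar A B Q)%E.
  case: (tstar A B Q) Tt => [r||] //.
  - rewrite lte_fin => Tr; exists ((T + r) / 2); last rewrite lte_fin.
      by rewrite midf_lt.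
    by rewrite midf_lt.
  - by move=> _; exists (T + 1); rewrite ?ltry// ltrDl.
exists T1 => // t /andP[t0 tT1]; apply: R3_unit => // ct.
have : (tstar A B Q <= t%:E)%E by apply: ereal_inf_lbound; exists t.
by move=> /(lt_le_trans T1t); rewrite lte_fin ltNge tT1.
Qed.

End HamiltonianFlow.

(** * The pointwise identity behind the completion of the square *)

Section CompletingTheSquare.
Variables (R : realType) (n m : nat).
Variables (A : 'M[R]_n) (B : 'M[R]_(n, m)) (Q : 'M[R]_n).
Hypothesis symQ : Q^T = Q.

(** Primed letters stand for time derivatives, with [x + e] in the role of gamma; the left side is
    the derivative of p . gamma + (p + S e) . e. The Riccati value of S' reduces the part quadratic
    in e to - e . Q e - |B^T S e|^2, and the remaining terms complete |w|^2. Once symmetry has moved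
    all matrices to a common side, the identity is polynomial in scalar products. *)
Lemma square_completion (p x e : 'cV[R]_n) (S : 'M[R]_n) (u : 'cV[R]_m) :
  S^T = S ->
  let p' := - (A^T *m p) - Q *m x in
  let x' := A *m x + B *m (B^T *m p) in
  let g' := A *m (x + e) + B *m u in
  let S' := - (A^T *m S) - Q - S *m (B *m B^T *m S + A) in
  let w := u - B^T *m (p + S *m e) in
  dot p' (x + e) + dot p g' +
  (dot (p' + (S' *m e + S *m (g' - x'))) e + dot (p + S *m e) (g' - x')) =
  dot u u - dot (x + e) (Q *m (x + e)) - dot w w.
Proof.
move=> symS /=; set s := S *m e.
have xe : A *m (x + e) + B *m u - (A *m x + B *m (B^T *m p)) =
    A *m e + B *m (u - B^T *m p).
  by rewrite !mulmxDr mulmxN -(addrA (A *m x)) opprD addrACA subrr add0r -addrA.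
rewrite xe.
have Se : (- (A^T *m S) - Q - S *m (B *m B^T *m S + A)) *m e =
    - (A^T *m s) - Q *m e - S *m (B *m (B^T *m s) + A *m e).
  by rewrite !mulmxBl mulNmx -!mulmxA mulmxDl -!mulmxA.
rewrite {}Se; set b := B^T *m s; set a := B^T *m p.
rewrite !(mulmxDr, mulmxN) -/a -/b -/s.
rewrite !(dotDl, dotDr, dotNl, dotNr).
have SE v : dot (S *m v) e = dot v s by rewrite dotMl symS.
have Sb v : dot v (B *m u) = dot (B^T *m v) u by rewrite dotMr.
have Sc v (c : 'cV[R]_m) : dot v (B *m c) = dot (B^T *m v) c by rewrite dotMr.
have At v z : dot (A^T *m v) z = dot v (A *m z) by rewrite dotMl trmxK.
have Qt v z : dot (Q *m v) z = dot v (Q *m z) by rewrite dotMl symQ.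
rewrite !(dotDl, dotDr, dotNl, dotNr, SE, At, Qt).
have Bl v (c : 'cV[R]_m) : dot (B *m c) v = dot c (B^T *m v) by rewrite dotMl.
rewrite !(Sc, Bl) -/a -/b (dotC (A *m e) s) (dotC u a) (dotC u b) (dotC b a).
have -> : dot e (Q *m x) = dot x (Q *m e) by rewrite -Qt dotC.
ring.
Qed.

End CompletingTheSquare.

(** * The action as a boundary term plus an integrated square *)

Section Action.
Variables (R : realType) (n m : nat).
Variables (A : 'M[R]_n) (B : 'M[R]_(n, m)) (Q : 'M[R]_n) (T : R).
Hypothesis symQ : Q^T = Q.
Hypothesis T0 : 0 < T.
Local Notation mu := (@lebesgue_measure R).

Lemma integrable_primitive (F f : R -> R) : primitive T F f ->
  mu.-integrable `[0, T] (EFin \o F).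
Proof.
move=> pF; apply: continuous_compact_integrable; first exact: segment_compact.
exact: primitive_within_continuous (ltW T0) pF.
Qed.

Lemma actionE (p xb : R -> 'cV[R]_n) (S : R -> 'M[R]_n) gamma
    (u : R -> 'cV[R]_m) x y :
  (forall t, 0 <= t <= T -> (S t)^T = S t) ->
  primitive_mx T p (fun t => - (A^T *m p t) - Q *m xb t) ->
  primitive_mx T xb (fun t => A *m xb t + B *m (B^T *m p t)) ->
  primitive_mx T S (fun t => - (A^T *m S t) - Q - S t *m (B *m B^T *m S t + A)) ->
  admissible A B T x y gamma u -> xb 0 = x -> xb T = y ->
  action Q T gamma u = 2^-1 * (dot (p T) y - dot (p 0) x) +
    2^-1 * \int[mu]_(t in `[0, T])
      sqnorm (u t - B^T *m (p t + S t *m (gamma t - xb t))).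
Proof.
move=> symS pp px pS [mu_u int_u intg Hg [g0 gT]] x0 xT.
have T0' := ltW T0.
have pg : primitive_mx T gamma (fun t => A *m gamma t + B *m u t).
  by move=> i j; rewrite ord1; split=> [|t tT]; [exact: intg|exact: Hg].
have pe := primitive_mxB pg px.
have pq := primitive_mxD pp (primitive_mxM T0' pS pe).
have := primitiveD (primitive_dot T0' pp pg) (primitive_dot T0' pq pe).
set Phi := (X in primitive T X _); set phi := (X in primitive T _ X) => -[intphi HPhi].
(* The error gamma - xb vanishes at both ends, so [S] drops out of the boundary values. *)
have PhiT : \int[mu]_(t in `[0, T]) phi t = dot (p T) y - dot (p 0) x.
  have := HPhi T; rewrite lexx T0' => /(_ isT).
  rewrite /Phi !g0 !gT x0 xT !subrr !mulmx0 !addr0 /dot !mulmx0 !mxE !addr0.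
  by move=> ->; rewrite addrC addKr.
pose q t := \sum_(i < m) (u t i 0) ^+ 2 - ((gamma t)^T *m Q *m gamma t) 0 0.
(* Integrability allows the integral of [q - phi] to be split: |u|^2 is integrable by admissibility,
   the quadratic form because gamma is continuous. *)
have intq : mu.-integrable `[0, T] (EFin \o q).
  have i1 : mu.-integrable `[0, T] (fun t => \sum_(i < m) ((u t i 0) ^+ 2)%:E)%E.
    by apply: integrable_sum => // i _; exact: int_u.
  have pQ := primitive_dot T0' pg (primitive_mxM T0' (primitive_mx_cst T Q) pg).
  have i2 := integrable_primitive pQ.
  have := integrableB (measurable_itvR _) i1 i2.
  by apply: eq_integrable => // t _; rewrite /q /dot /= sumEFin mulmxA EFinB.
have -> : \int[mu]_(t in `[0, T])
      sqnorm (u t - B^T *m (p t + S t *m (gamma t - xb t))) =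
   \int[mu]_(t in `[0, T]) (q t - phi t).
  apply: eq_Rintegral => t; rewrite inE /= in_itv /= => tT.
  have := square_completion A B symQ (p t) (xb t) (gamma t - xb t) (u t) (symS t tT).
  rewrite /= [xb t + _]addrC subrK => H.
  rewrite /phi H /q -mulmxA -/(dot _ (Q *m _)).
  have -> : \sum_(i < m) u t i 0 ^+ 2 = dot (u t) (u t).
    by rewrite dotE; apply: eq_bigr => i _; rewrite expr2.
  by rewrite opprB [RHS]addrC subrK.
rewrite RintegralB// PhiT /action -/(q _) -mulrDr; congr (_ * _).
by rewrite addrC subrK.
Qed.

End Action.

(** * The extremal trajectory and the Riccati solution read off the flow *)

Section Extremal.
Variables (R : realType) (n m : nat).
Variables (A : 'M[R]_n) (B : 'M[R]_(n, m)) (Q : 'M[R]_n) (T : R).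
Hypothesis symQ : Q^T = Q.
Hypothesis T0 : 0 < T.
Local Notation E := (flow A B Q).
Local Notation R1 := (R1 A B Q).
Local Notation R3 := (R3 A B Q).
Local Notation R4 := (R4 A B Q).
Local Notation mu := (@lebesgue_measure R).

Lemma primitive_extremal (z0 : 'cV[R]_(n + n)) :
  let p t := usubmx (E t *m z0) in let xb t := dsubmx (E t *m z0) in
  primitive_mx T p (fun t => - (A^T *m p t) - Q *m xb t) /\
  primitive_mx T xb (fun t => A *m xb t + B *m (B^T *m p t)).
Proof.
have pz := primitive_mxM (ltW T0) (primitive_flow0 A B Q T0) (primitive_mx_cst T z0).
have Ez t : ham_gen A B Q *m E t *m z0 + E t *m 0 =
  col_mx (- (A^T *m usubmx (E t *m z0)) - Q *m dsubmx (E t *m z0))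
   (A *m dsubmx (E t *m z0) + B *m (B^T *m usubmx (E t *m z0))).
  rewrite mulmx0 addr0 -mulmxA -{1}[E t *m z0]vsubmxK mul_block_col !mulNmx.
  by rewrite -mulmxA [in X in col_mx _ X]addrC.
move=> /=; split.
- have := primitive_mx_sub (lshift n) id pz.
  by congr (primitive_mx T _ _); apply/funext => t; rewrite -usubmxEsub ?Ez ?col_mxKu.
- have := primitive_mx_sub (@rshift n n) id pz.
  by congr (primitive_mx T _ _); apply/funext => t; rewrite -dsubmxEsub ?Ez ?col_mxKd.
Qed.

(* Shifting time by [eps] keeps R3 (t + eps) invertible down to t = 0. *)
Lemma primitive_riccati (eps : R) : 0 < eps ->
  (forall t, 0 < t <= T + eps -> R3 t \in unitmx) ->
  let S t := R1 (eps + t) *m invmx (R3 (eps + t)) in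
  (forall t, 0 <= t <= T -> (S t)^T = S t) /\
  primitive_mx T S (fun t => - (A^T *m S t) - Q - S t *m (B *m B^T *m S t + A)).
Proof.
move=> e0 uR /=.
have uX t : 0 <= t <= T -> R3 (eps + t) \in unitmx.
  by move=> /andP[t0 tT]; apply: uR; rewrite addrC lerD2r tT ltr_wpDl.
pose X t := R3 (eps + t); pose P t := R1 (eps + t).
have NE t : ham_gen A B Q *m E t =
   block_mx (- (A^T *m R1 t) - Q *m R3 t) (- (A^T *m R2 A B Q t) - Q *m R4 t)
     (B *m B^T *m R1 t + A *m R3 t) (B *m B^T *m R2 A B Q t + A *m R4 t).
  by rewrite flow_block /ham_gen mulmx_block !mulNmx.
have HE t := is_derive_flow A B Q eps 1 t.
have HX t : is_derive_mx X t (B *m B^T *m P t + A *m X t).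
  move=> i j; have := HE t (rshift n i) (lshift n j).
  rewrite scale1r mul1r NE block_mxEdl.
  by under [Z in is_derive _ _ Z _ -> _]funext do rewrite mul1r flow_block block_mxEdl.
have HP t : is_derive_mx P t (- (A^T *m P t) - Q *m X t).
  move=> i j; have := HE t (lshift n i) (lshift n j).
  rewrite scale1r mul1r NE block_mxEul.
  by under [Z in is_derive _ _ Z _ -> _]funext do rewrite mul1r flow_block block_mxEul.
have cP t := is_derive_mx_continuous (HP t).
have cX t := is_derive_mx_continuous (HX t).
have cc a b (M : 'M[R]_(a, b)) t : continuous_mx (fun=> M) t.
  by move=> i j; exact: cvg_cst.
have cdX t : continuous_mx (fun t => B *m B^T *m P t + A *m X t) t.
  exact: (continuous_mxD (continuous_mxM (cc _ _ _ t) (cP t))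
    (continuous_mxM (cc _ _ _ t) (cX t))).
have cdP t : continuous_mx (fun t => - (A^T *m P t) - Q *m X t) t.
  apply: continuous_mxD; apply: continuous_mxN.
    exact: (continuous_mxM (cc _ _ _ t) (cP t)).
  exact: (continuous_mxM (cc _ _ _ t) (cX t)).
have pP := continuous_primitive_mx T0 (fun t _ => HP t) (fun t _ => cdP t).
have pX := primitive_mx_invmx T0 uX (fun t _ => HX t) (fun t _ => cdX t).
split=> [t tT|].
  have et0 : 0 < eps + t by case/andP: tT => t0 _; rewrite ltr_wpDr.
  have sym := R13_sym A B symQ et0.
  have uXt := uX t tT; have uXt' : (X t)^T \in unitmx by rewrite unitmx_tr.
  (* Multiplying by the transpose of [X t] clears the inverses and leaves [R13_sym]. *)
  rewrite trmx_mul trmx_inv; apply: (can_inj (mulKmx uXt')).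
  rewrite mulKVmx// mulmxA -sym -mulmxA mulmxV// mulmx1//.
(* The product rule gives S' = P' X^-1 - P X^-1 X' X^-1; inserting the linear equations for P and X
   and cancelling X X^-1 yields the Riccati equation. *)
apply: eq_primitive_mx (primitive_mxM (ltW T0) pP pX) => //; first exact: ltW.
move=> t tT; have uXt := uX t tT; rewrite -/(X t) -/(P t).
set Y := invmx (X t); have XY : X t *m Y = 1%:M by rewrite mulmxV.
have -> : Y *m (B *m B^T *m P t + A *m X t) *m Y = Y *m (B *m B^T *m (P t *m Y) + A).
  by rewrite -mulmxA mulmxDl -[A *m X t *m Y]mulmxA XY mulmx1 -[_ *m P t *m Y]mulmxA.
rewrite mulmxN mulmxBl mulNmx -[A^T *m P t *m Y]mulmxA -[Q *m X t *m Y]mulmxA XY.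
by rewrite mulmx1 [P t *m (Y *m _)]mulmxA.
Qed.

End Extremal.

(** * The boundary term and the cost formula *)

Lemma primitive_mx_measurable (R : realType) (T : R) a b (F f : R -> 'M[R]_(a, b)) i j :
  0 <= T -> primitive_mx T F f -> measurable_fun `[0, T] (fun t => F t i j).
Proof.
move=> T0 pF; apply: subspace_continuous_measurable_fun => //.
exact: primitive_within_continuous (pF i j).
Qed.

(** To be read with X = R3(T), Y = R3(-T), C = R4(T), D = R4(-T). Since Y = - X^T, the two mixed
    terms are equal, and the factor 1/2 turns them into the single term in x and y. *)
Lemma boundary_cost (R : realType) n (x y : 'cV[R]_n) (X Y C D : 'M[R]_n) :
  X \in unitmx -> Y = - X^T ->
  2^-1 * (dot (invmx Y *m (x - D *m y)) y - dot (invmx X *m (y - C *m x)) x) =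
  (x^T *m invmx X *m C *m x) 0 0 / 2 - (x^T *m invmx X *m y) 0 0
  - (y^T *m invmx Y *m D *m y) 0 0 / 2.
Proof.
move=> uX YE.
have uY : Y \in unitmx.
  by rewrite YE unitmxE -scaleN1r detZ det_tr unitrMl -?unitmxE// unitrX// unitrN1.
have cross : dot y (invmx Y *m x) = - dot x (invmx X *m y).
  rewrite -{1}(mulKVmx uX y) dotMl -[_^T]opprK -YE mulNmx (mulKVmx uY).
  by rewrite dotNr dotC.
rewrite (dotC _ y) (dotC _ x) !mulmxBr !dotDr !dotNr cross /dot !mulmxA.
by field.
Qed.

Theorem theorem2p16 (R : realType) (n m : nat)
    (A : 'M[R]_n) (B : 'M[R]_(n, m)) (Q : 'M[R]_n) (T : R) :
  (m <= n)%N -> \rank B = m -> Q^T = Q ->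
  kalman A B -> 0 < T -> (T%:E < tstar A B Q)%E ->
  R3 A B Q T \in unitmx /\ R3 A B Q (- T) \in unitmx /\
  forall x y : 'cV[R]_n,
    lq_cost A B Q T x y =
      ((x^T *m invmx (R3 A B Q T) *m R4 A B Q T *m x) 0 0 / 2
       - (x^T *m invmx (R3 A B Q T) *m y) 0 0
       - (y^T *m invmx (R3 A B Q (- T)) *m R4 A B Q (- T) *m y) 0 0 / 2)%:E.
Proof.
move=> _ _ symQ _ T0 /R3_unit_past[T1 TT1 uR].
have uT : R3 A B Q T \in unitmx by apply: uR; rewrite T0 ltW.
have RN := R3N A B symQ T0.
have uN : R3 A B Q (- T) \in unitmx.
  by rewrite RN unitmxE -scaleN1r detZ det_tr unitrMl -?unitmxE// unitrX// unitrN1.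
split=> //; split=> // x y.
have T0' := ltW T0.
(* Initial covector solving R3(T) p0 + R4(T) x = y, so that the extremal from x reaches y at time
   T. *)
pose p0 := invmx (R3 A B Q T) *m (y - R4 A B Q T *m x).
pose z t := flow A B Q t *m col_mx p0 x.
pose p t := usubmx (z t); pose xb t := dsubmx (z t).
have [pp px] := primitive_extremal A B Q T0 (col_mx p0 x).
have z0 : z 0 = col_mx p0 x by rewrite /z flow0 mul1mx.
have p00 : p 0 = p0 by rewrite /p z0 col_mxKu.
have xb0 : xb 0 = x by rewrite /xb z0 col_mxKd.
have xbT : xb T = y.
  by rewrite /xb /z flow_block mul_block_col col_mxKd (mulKVmx uT) subrK.
(* The backward flow takes (p(T), y) to (p0, x); its lower row is solved for p(T). *)
have pT : p T = invmx (R3 A B Q (- T)) *m (x - R4 A B Q (- T) *m y).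
  have : flow A B Q (- T) *m z T = col_mx p0 x by rewrite mulmxA flowN// mul1mx.
  rewrite -[z T]vsubmxK -/(p T) -/(xb T) xbT flow_block mul_block_col.
  by move=> /eq_col_mx[_ <-]; rewrite addrK mulKmx.
have adm : admissible A B T x y xb (fun t => B^T *m p t).
  have pu := primitive_mxM T0' (primitive_mx_cst T B^T) pp.
  split=> // [i|i|i|t tT i].
  - exact: primitive_mx_measurable pu.
  (* The extremal control is continuous, hence square integrable. *)
  - have cu := primitive_within_continuous T0' (pu i 0).
    have := within_continuous_integrableM T0' cu (integrable_primitive T0 (pu i 0)).
    by apply: eq_integrable.
  - by have [] := px i 0.
  - by have [_ ->] := px i 0.
have e0 : 0 < T1 - T by rewrite subr_gt0.
have uR' t : 0 < t <= T + (T1 - T) -> R3 A B Q t \in unitmx.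
  by rewrite addrC subrK; exact: uR.
have [symS pS] := primitive_riccati symQ T0 e0 uR'.
set c := (X in _ = X%:E).
have cE : c = 2^-1 * (dot (p T) y - dot (p 0) x).
  by rewrite p00 pT /p0 (boundary_cost x y _ _ uT RN).
have key gamma u (ad : admissible A B T x y gamma u) :=
  actionE symQ T0 symS pp px pS ad xb0 xbT.
apply/eqP; rewrite /lq_cost eq_le; apply/andP; split.
  (* The extremal attains the value: its error term and its w both vanish identically. *)
  apply: ereal_inf_lbound; exists xb, (fun t => B^T *m p t); split => //.
  rewrite (key _ _ adm) -cE; congr EFin.
  under eq_Rintegral do rewrite subrr mulmx0 addr0 subrr /sqnorm dot0l.
  by rewrite Rintegral_cst// mul0r mulr0 addr0.
(* Any competitor exceeds the boundary term by half the integral of a squared norm. *)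
apply: le_ereal_inf_tmp => _ [gamma [u [ad ->]]].
rewrite lee_fin (key _ _ ad) -cE lerDl mulr_ge0//.
by apply: Rintegral_ge0 => t _; exact: sqnorm_ge0.
Qed.
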